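(* Let $n$ be a positive integer. Let $\mathbb{Z}^{n(n-1)/2}$ be the free abelian group of rank $n(n-1)/2$ with free basis $x_{i,j}$, $1\le i<j\le n$, and set $x_{j,i}:=x_{i,j}^{-1}$ for $1\le i<j\le n$. Then the flat welded braid group $FWB_n$ is isomorphic to $\mathbb{Z}^{n(n-1)/2}\rtimes S_n$, where the symmetric group $S_n$ acts by permutation of the indices of the generators, $s\cdot x_{i,j}=x_{s(i),s(j)}$.
   Context: The virtual braid group $VB_n$ is the group with generators $\sigma_1,\dots,\sigma_{n-1},\rho_1,\dots,\rho_{n-1}$ and defining relations: (R1) $\sigma_i\sigma_{i+1}\sigma_i=\sigma_{i+1}\sigma_i\sigma_{i+1}$ for $1\le i\le n-2$; (R2) $\sigma_i\sigma_j=\sigma_j\sigma_i$ for $|i-j|\ge 2$; (R3) $\rho_i\rho_{i+1}\rho_i=\rho_{i+1}\rho_i\rho_{i+1}$ for $1\le i\le n-2$; (R4) $\rho_i\rho_j=\rho_j\rho_i$ for $|i-j|\ge 2$; (R5) $\rho_i^2=1$ for $1\le i\le n-1$; (R6) $\sigma_i\rho_j=\rho_j\sigma_i$ for $|i-j|\ge 2$; (M) $\rho_i\rho_{i+1}\sigma_i=\sigma_{i+1}\rho_i\rho_{i+1}$ for $1\le i\le n-2$. The welded braid group $WB_n$ is the quotient of $VB_n$ by the relations (F1) $\rho_i\sigma_{i+1}\sigma_i=\sigma_{i+1}\sigma_i\rho_{i+1}$ for $1\le i\le n-2$. The flat welded braid group $FWB_n$ is the quotient of $WB_n$ by the relations $\sigma_i^2=1$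 for $1\le i\le n-1$. *)

(* Defs.v *)
From HB Require Import structures.
From mathcomp Require Import all_boot all_order all_fingroup all_algebra.
From mathcomp Require Import boolp.

Set Implicit Arguments.
Unset Strict Implicit.
Unset Printing Implicit Defensive.

Import GRing.Theory.

Local Open Scope group_scope.
Local Open Scope quotient_scope.

Section MonoidQuotient.
Variables (M : monoidType) (R : M -> M -> Prop).

(* The smallest congruence containing R. *)
Inductive cong : M -> M -> Prop :=
| cong_base x y : R x y -> cong x y
| cong_refl x : cong x x
| cong_sym x y : cong x y -> cong y x
| cong_trans y x z : cong x y -> cong y z -> cong x z
| cong_mul x x' y y' : cong x x' -> cong y y' -> cong (x * y) (x' * y').

Definition congb : rel M := fun x y => `[< cong x y >].

Lemma congb_refl : reflexive congb.
Proof. by move=> x; apply/asboolP/cong_refl. Qed.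

Lemma congb_sym : symmetric congb.
Proof. by move=> x y; apply/asboolP/asboolP => /cong_sym. Qed.

Lemma congb_trans : transitive congb.
Proof.
by move=> y x z /asboolP xy /asboolP yz; apply/asboolP/(cong_trans xy yz).
Qed.

Canonical congb_equiv := EquivRel congb congb_refl congb_sym congb_trans.

Definition mquo : Type := {eq_quot congb_equiv}.
HB.instance Definition _ := Choice.on mquo.

Definition mquo_pi (x : M) : mquo := \pi_{eq_quot congb_equiv} x.
Definition mquo_repr (a : mquo) : M := generic_quotient.repr (a : {eq_quot congb_equiv}).

Lemma mquo_reprK : cancel mquo_repr mquo_pi.
Proof. exact: reprK. Qed.

Lemma mquo_piP x y : mquo_pi x = mquo_pi y <-> cong x y.
Proof.
split=> [/eqmodP/asboolP //|xy].
by apply/eqmodP/asboolP.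
Qed.

Lemma mquo_piK x : cong (mquo_repr (mquo_pi x)) x.
Proof. by apply/mquo_piP; rewrite mquo_reprK. Qed.

Definition mquo_mul (a b : mquo) : mquo :=
  mquo_pi (mquo_repr a * mquo_repr b).

Lemma mquo_mulE x y : mquo_mul (mquo_pi x) (mquo_pi y) = mquo_pi (x * y).
Proof. by apply/mquo_piP/cong_mul; apply: mquo_piK. Qed.

Lemma mquo_mulA : associative mquo_mul.
Proof.
move=> a b c; rewrite -[a]mquo_reprK -[b]mquo_reprK -[c]mquo_reprK.
by rewrite !mquo_mulE mulgA.
Qed.

Lemma mquo_mul1 : left_id (mquo_pi 1) mquo_mul.
Proof. by move=> a; rewrite -[a]mquo_reprK mquo_mulE mul1g. Qed.

Lemma mquo_mulr1 : right_id (mquo_pi 1) mquo_mul.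
Proof. by move=> a; rewrite -[a]mquo_reprK mquo_mulE mulg1. Qed.

HB.instance Definition _ :=
  isMonoid.Build mquo mquo_mulA mquo_mul1 mquo_mulr1.

End MonoidQuotient.

Section GroupQuotient.
Variables (G : groupType) (R : G -> G -> Prop).

(* The quotient of G by the relations x = y for R x y, that is, by the normal
   closure of the elements x * y^-1. *)
Definition gquo : Type := mquo R.
HB.instance Definition _ := Monoid.on gquo.

Definition gquo_pi (x : G) : gquo := mquo_pi R x.

Definition gquo_inv (a : gquo) : gquo := gquo_pi (mquo_repr a)^-1.

Lemma gquo_mulV : left_inverse 1 gquo_inv *%g.
Proof.
move=> a; rewrite -{2}[a]mquo_reprK.
by rewrite [LHS]mquo_mulE mulVg.
Qed.

Lemma gquo_mulrV : right_inverse 1 gquo_inv *%g.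
Proof.
move=> a; rewrite -{1}[a]mquo_reprK.
by rewrite [LHS]mquo_mulE mulgV.
Qed.

HB.instance Definition _ := hasInv.Build gquo gquo_inv.
HB.instance Definition _ := Monoid_isGroup.Build gquo gquo_mulV gquo_mulrV.

End GroupQuotient.

Section FreeGroup.
Variable T : choiceType.

(* The letter (t, false) stands for t, the letter (t, true) for t^-1. *)
Definition word : Type := seq (T * bool).
HB.instance Definition _ := Choice.on word.
HB.instance Definition _ :=
  isMonoid.Build word (@catA _) (@cat0s _) (@cats0 _).

Definition flip (l : T * bool) : T * bool := (l.1, ~~ l.2).

Inductive cancel_rel : word -> word -> Prop :=
| Cancel l : cancel_rel [:: l; flip l] [::].

Definition free_group : Type := mquo cancel_rel.
HB.instance Definition _ := Monoid.on free_group.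

Definition free_gen (t : T) : free_group := mquo_pi cancel_rel [:: (t, false)].

Definition word_inv (w : word) : word := rev (map flip w).

Lemma flipK : involutive flip.
Proof. by case=> t b; rewrite /flip /= negbK. Qed.

Lemma word_invK : involutive word_inv.
Proof.
by move=> w; rewrite /word_inv map_rev revK -map_comp map_id_in // => l _ /=;
  rewrite flipK.
Qed.

Lemma word_mulV w : cong cancel_rel (w ++ word_inv w) [::].
Proof.
elim: w => [|l w IHw]; first exact: cong_refl.
rewrite /word_inv /= rev_cons -cats1 -cat_cons catA -/(word_inv w).
apply: cong_trans (cong_base (Cancel l)).
have refl1 x := cong_refl cancel_rel ([:: x] : word).
exact: cong_mul (cong_mul (refl1 l) IHw) (refl1 (flip l)).
Qed.

Definition free_inv (a : free_group) : free_group :=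
  mquo_pi cancel_rel (word_inv (mquo_repr a)).

Lemma free_mulV : left_inverse 1 free_inv *%g.
Proof.
move=> a; rewrite -{2}[a]mquo_reprK [LHS]mquo_mulE; apply/mquo_piP.
by have := word_mulV (word_inv (mquo_repr a)); rewrite word_invK.
Qed.

Lemma free_mulrV : right_inverse 1 free_inv *%g.
Proof.
move=> a; rewrite -{1}[a]mquo_reprK [LHS]mquo_mulE; apply/mquo_piP.
exact: word_mulV.
Qed.

HB.instance Definition _ := hasInv.Build free_group free_inv.
HB.instance Definition _ :=
  Monoid_isGroup.Build free_group free_mulV free_mulrV.

End FreeGroup.

(* Indices run from 0: for i : 'I_n.-1, sg i and rh i below are the generators
   sigma_(i+1) and rho_(i+1). *)
Definition vb_gen (n : nat) : choiceType := ('I_n.-1 + 'I_n.-1)%type.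

(* |i - j| >= 2 *)
Definition far (i j : nat) : bool := (i.+2 <= j) || (j.+2 <= i).

Section BraidGroups.
Variable n : nat.

Definition fg_sg (i : 'I_n.-1) : free_group (vb_gen n) :=
  @free_gen (vb_gen n) (inl i).
Definition fg_rh (i : 'I_n.-1) : free_group (vb_gen n) :=
  @free_gen (vb_gen n) (inr i).

Inductive VB_rel : free_group (vb_gen n) -> free_group (vb_gen n) -> Prop :=
| VB_R1 (i j : 'I_n.-1) : j = i.+1 :> nat ->
    VB_rel (fg_sg i * fg_sg j * fg_sg i) (fg_sg j * fg_sg i * fg_sg j)
| VB_R2 (i j : 'I_n.-1) : far i j ->
    VB_rel (fg_sg i * fg_sg j) (fg_sg j * fg_sg i)
| VB_R3 (i j : 'I_n.-1) : j = i.+1 :> nat ->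
    VB_rel (fg_rh i * fg_rh j * fg_rh i) (fg_rh j * fg_rh i * fg_rh j)
| VB_R4 (i j : 'I_n.-1) : far i j ->
    VB_rel (fg_rh i * fg_rh j) (fg_rh j * fg_rh i)
| VB_R5 (i : 'I_n.-1) :
    VB_rel (fg_rh i ^+ 2) 1
| VB_R6 (i j : 'I_n.-1) : far i j ->
    VB_rel (fg_sg i * fg_rh j) (fg_rh j * fg_sg i)
| VB_M (i j : 'I_n.-1) : j = i.+1 :> nat ->
    VB_rel (fg_rh i * fg_rh j * fg_sg i) (fg_sg j * fg_rh i * fg_rh j).

Definition VB : groupType := gquo VB_rel.
Definition VB_sg (i : 'I_n.-1) : VB := gquo_pi VB_rel (fg_sg i).
Definition VB_rh (i : 'I_n.-1) : VB := gquo_pi VB_rel (fg_rh i).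

Inductive WB_rel : VB -> VB -> Prop :=
| WB_F1 (i j : 'I_n.-1) : j = i.+1 :> nat ->
    WB_rel (VB_rh i * VB_sg j * VB_sg i) (VB_sg j * VB_sg i * VB_rh j).

Definition WB : groupType := gquo WB_rel.
Definition WB_sg (i : 'I_n.-1) : WB := gquo_pi WB_rel (VB_sg i).
Definition WB_rh (i : 'I_n.-1) : WB := gquo_pi WB_rel (VB_rh i).

Inductive FWB_rel : WB -> WB -> Prop :=
| FWB_sq (i : 'I_n.-1) : FWB_rel (WB_sg i ^+ 2) 1.

Definition FWB : groupType := gquo FWB_rel.

End BraidGroups.

Section SemidirectProduct.
Variable n : nat.

Definition pairs : finType := {p : 'I_n * 'I_n | (p.1 < p.2)%N}.

(* The free abelian group with basis indexed by the pairs i < j, written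
   additively, so that x_{j,i} = x_{i,j}^-1 becomes xgen j i = - xgen i j. *)
Definition Zpairs : zmodType := {ffun pairs -> int}.

Definition xbasis (i j : 'I_n) : Zpairs := [ffun p => (val p == (i, j))%:R%R].

(* xgen i i = 0; this value is never used. *)
Definition xgen (i j : 'I_n) : Zpairs :=
  (if (i < j)%N then xbasis i j else - xbasis j i)%R.

Definition xact (s : 'S_n) (v : Zpairs) : Zpairs :=
  (\sum_(p : pairs) xgen (s (val p).1) (s (val p).2) *~ v p)%R.

Lemma xgenN i j : xgen j i = (- xgen i j)%R.
Proof.
rewrite /xgen; case: ltngtP => [_|_|/val_inj ->]; rewrite ?opprK //.
by apply/ffunP => p; rewrite !ffunE; case: p => [[a b] /= ab];
  case: eqP ab => [[-> ->]|]; rewrite ?ltnn ?oppr0.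
Qed.

Lemma xactD s : {morph xact s : v w / (v + w)%R}.
Proof.
move=> v w; rewrite /xact -big_split /=; apply: eq_bigr => p _.
by rewrite ffunE mulrzDr.
Qed.

Lemma xact0 s : xact s 0%R = 0%R.
Proof. by apply: (addrI (xact s 0%R)); rewrite -xactD !addr0. Qed.

Lemma xactN s v : xact s (- v)%R = (- xact s v)%R.
Proof. by apply: (addrI (xact s v)); rewrite -xactD !subrr xact0. Qed.

Lemma xactMz s v (m : int) : xact s (v *~ m)%R = (xact s v *~ m)%R.
Proof.
have xactMn k : xact s (v *+ k)%R = (xact s v *+ k)%R.
  by elim: k => [|k IHk]; rewrite ?mulr0n ?xact0 // !mulrS xactD IHk.
by case: m => k; rewrite /intmul ?xactN xactMn.
Qed.

Lemma xact_sum s (I : finType) (F : I -> Zpairs) :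
  xact s (\sum_i F i)%R = (\sum_i xact s (F i))%R.
Proof. exact: (big_morph _ (xactD s) (xact0 s)). Qed.

Lemma xact_gen s i j : xact s (xgen i j) = xgen (s i) (s j).
Proof.
have xact_basis (a b : 'I_n) : (a < b)%N -> xact s (xbasis a b) = xgen (s a) (s b).
  move=> ab; rewrite /xact (bigD1 (Sub (a, b) ab : pairs)) //=.
  rewrite ffunE /= eqxx mulr1z big1 ?addr0 // => p np.
  by rewrite ffunE; have := np; rewrite -val_eqE /= => /negbTE ->; rewrite mulr0z.
rewrite {1}/xgen; case: (ltngtP i j) => [ij|ji|/val_inj ->].
- exact: xact_basis.
- by rewrite xactN xact_basis // -xgenN.
have xgenii k : xbasis k k = 0%R.
  apply/ffunP => -[[a b] /= ab]; rewrite !ffunE /=.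
  by case: eqP ab => [[-> ->]|]; rewrite ?ltnn.
by rewrite xgenii oppr0 xact0 /xgen ltnn xgenii oppr0.
Qed.

Lemma xact1 v : xact 1 v = v.
Proof.
apply/ffunP => q; rewrite /xact sum_ffunE (bigD1 q) //= !perm1 big1.
  by rewrite addr0 /xgen (valP q) ffunMzE ffunE -surjective_pairing eqxx intz.
move=> p npq; rewrite !perm1 /xgen (valP p) ffunMzE ffunE -surjective_pairing.
by rewrite val_eqE eq_sym (negbTE npq) mul0rz.
Qed.

Lemma xactM s t v : xact (t * s) v = xact s (xact t v).
Proof.
rewrite {3}/xact xact_sum; apply: eq_bigr => p _.
by rewrite xactMz xact_gen !permM.
Qed.

Definition ZS : Type := (Zpairs * 'S_n)%type.
HB.instance Definition _ := Choice.on ZS.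

(* The product of (v, s) and (w, t) is (v + s . w, s \o t): MathComp composes
   permutations from left to right, so (t * s) i = s (t i). *)
Definition ZS_mul (a b : ZS) : ZS := ((a.1 + xact a.2 b.1)%R, b.2 * a.2).
Definition ZS_one : ZS := (0%R, 1).
Definition ZS_inv (a : ZS) : ZS := ((- xact a.2^-1 a.1)%R, a.2^-1).

Lemma ZS_mulA : associative ZS_mul.
Proof. by move=> a b c; rewrite /ZS_mul /= xactD xactM addrA mulgA. Qed.

Lemma ZS_mul1 : left_id ZS_one ZS_mul.
Proof. by case=> v s; rewrite /ZS_mul /= xact1 add0r mulg1. Qed.

Lemma ZS_mulr1 : right_id ZS_one ZS_mul.
Proof. by case=> v s; rewrite /ZS_mul /= xact0 addr0 mul1g. Qed.

Lemma ZS_mulV : left_inverse ZS_one ZS_inv ZS_mul.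
Proof. by case=> v s; rewrite /ZS_mul /= addNr mulgV. Qed.

Lemma ZS_mulrV : right_inverse ZS_one ZS_inv ZS_mul.
Proof.
by case=> v s; rewrite /ZS_mul /= xactN -xactM mulVg xact1 subrr.
Qed.

HB.instance Definition _ :=
  isGroup.Build ZS ZS_mulA ZS_mul1 ZS_mulr1 ZS_mulV ZS_mulrV.

End SemidirectProduct.

Definition isomorphic (G H : groupType) : Prop :=
  exists f : {multiplicative G -> H}, bijective f.

(* Main.v *)
(** The isomorphism f sends rho_i to (0, s_i) and sigma_i to (x_{i,i+1}, s_i).
    By the braid relations a product of the rho's with indices >= k is a coset
    representative, read off from the image of k, times a product of rho's with
    indices > k. Iterating, the rho's generate a copy of S_n, and the stabiliser
    of the first two points is generated by the rho's commuting with
    alpha = sigma_1 rho_1. Hence the conjugates alpha_{i,j} of alpha depend only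
    on the images i, j of these points and are permuted by S_n. The relation
    sigma_1^2 = 1 gives alpha_{j,i} = alpha_{i,j}^-1, F1 says that alpha_{i,k}
    and alpha_{j,k} commute, and disjoint pairs commute by (R2), (R4) and (R6).
    So every element is a monomial in the alpha_{i,j}, i < j, times an element
    of S_n, and f reads off both the exponents and the permutation. *)

Require Import Defs.
From mathcomp Require Import all_boot.
From HB Require Import structures.
From mathcomp Require Import all_order all_fingroup all_algebra.
From mathcomp Require Import boolp zify.

Set Implicit Arguments.
Unset Strict Implicit.
Unset Printing Implicit Defensive.

Import GRing.Theory.
Local Open Scope group_scope.

(** * Groups satisfying the flat welded relations, with a map to the semidirect product *)

Section Presentation.
Variables (m : nat) (G : groupType) (sg rh : nat -> G) 
  (f : UMagmaMorphism.type G (ZS m.+1)).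

Definition adj (i : nat) : 'S_m.+1 := tperm (inord i) (inord i.+1).

Hypothesis f_rh : forall i, i < m -> f (rh i) = (0%R, adj i).
Hypothesis f_sg : forall i, i < m ->
  f (sg i) = (xgen (inord i) (inord i.+1), adj i).
Hypothesis rh_braid : forall i, i.+1 < m ->
  rh i * rh i.+1 * rh i = rh i.+1 * rh i * rh i.+1.
Hypothesis rhC : forall i j, i < m -> j < m -> far i j ->
  commute (rh i) (rh j).
Hypothesis rhK : forall i, i < m -> rh i * rh i = 1.
Hypothesis sgK : forall i, i < m -> sg i * sg i = 1.
Hypothesis sgC : forall i j, i < m -> j < m -> far i j ->
  commute (sg i) (sg j).
Hypothesis sg_rhC : forall i j, i < m -> j < m -> far i j ->
  commute (sg i) (rh j).
Hypothesis mixed : forall i, i.+1 < m ->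
  rh i * rh i.+1 * sg i = sg i.+1 * rh i * rh i.+1.
Hypothesis forbidden : forall i, i.+1 < m ->
  rh i * sg i.+1 * sg i = sg i.+1 * sg i * rh i.+1.
(** Induction on words in the generators; inverse letters need no clause because every generator is
    an involution. *)
Hypothesis generated : forall P : G -> Prop, P 1 ->
  (forall i x, i < m -> P x -> P (rh i * x)) ->
  (forall i x, i < m -> P x -> P (sg i * x)) -> forall x, P x.

(** This is a left action: the product of [ZS] multiplies the permutations in reverse order, which
    undoes the left-to-right composition of ['S_n]. *)
Definition act (x : G) : 'I_m.+1 -> 'I_m.+1 := (f x).2.

Lemma actM x y i : act (x * y) i = act x (act y i).
Proof. by rewrite /act gmulfM /= permM. Qed.

Lemma act1 i : act 1 i = i.
Proof. by rewrite /act gmulf1 /= perm1. Qed.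

Lemma actK x : cancel (act x) (act x^-1).
Proof. by move=> i; rewrite -actM mulVg act1. Qed.

Lemma act_rh i : i < m -> act (rh i) =1 adj i.
Proof. by move=> im j; rewrite /act f_rh. Qed.

Lemma inord_eq i j : i <= m -> j <= m ->
  (inord i == inord j :> 'I_m.+1) = (i == j).
Proof. by move=> im jm; rewrite -val_eqE /= !inordK. Qed.

Lemma act_rhL i : i < m -> act (rh i) (inord i) = inord i.+1.
Proof. by move=> im; rewrite act_rh // tpermL. Qed.

Lemma act_rhR i : i < m -> act (rh i) (inord i.+1) = inord i.
Proof. by move=> im; rewrite act_rh // tpermR. Qed.

Lemma act_rhD i j : i < m -> j <= m -> j != i -> j != i.+1 ->
  act (rh i) (inord j) = inord j.
Proof.
move=> im jm ji ji1; rewrite act_rh // tpermD // inord_eq //; first 2 [lia].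
all: by rewrite eq_sym.
Qed.

(** * Subgroups generated by the rho's of index at least k, and their cosets *)

Inductive gen (k : nat) : G -> Prop :=
| gen1 : gen k 1
| gen_rh i x : k <= i < m -> gen k x -> gen k (rh i * x).

Lemma genM k x y : gen k x -> gen k y -> gen k (x * y).
Proof.
move=> gx gy; elim: gx => [|i z ki _ IH]; rewrite ?mul1g // -mulgA.
exact: gen_rh.
Qed.

Lemma gen_rh1 k i : k <= i < m -> gen k (rh i).
Proof. by move=> ki; rewrite -[rh i]mulg1; apply/gen_rh/gen1. Qed.

Lemma rhV i : i < m -> (rh i)^-1 = rh i.
Proof. by move=> im; apply: mulg1_eq; apply: rhK. Qed.

Lemma rhKl i x : i < m -> rh i * (rh i * x) = x.
Proof. by move=> im; rewrite mulgA rhK ?mul1g. Qed.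

Lemma genV k x : gen k x -> gen k x^-1.
Proof.
elim=> [|i y ki _ IH]; first by rewrite invg1; apply: gen1.
by rewrite invgM rhV; [apply/genM/gen_rh1|lia].
Qed.

Lemma gen_f x : gen 0 x -> (f x).1 = 0%R.
Proof.
elim=> [|i y im _ IH]; first by rewrite gmulf1.
by rewrite gmulfM /= f_rh //= IH xact0 addr0.
Qed.

Lemma gen_fix k x j : gen k x -> j < k -> j <= m -> act x (inord j) = inord j.
Proof.
move=> gx jk jm; elim: gx => [|i y ki _ IH]; first by rewrite act1.
by rewrite actM IH act_rhD //; lia.
Qed.

Lemma gen_sub k l x : k <= l -> gen l x -> gen k x.
Proof.
by move=> kl; elim=> [|i y li _ IH]; [apply: gen1|apply: gen_rh => //; lia].
Qed.

Lemma gen_ge k x : m <= k -> gen k x -> x = 1.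
Proof. by move=> mk [//|i y ki _]; lia. Qed.

(* The minimal coset representatives of the parabolic subgroup generated by
   rho_{k+1}, ..., rho_{m-1} in the one generated by rho_k, ..., rho_{m-1}. *)
Fixpoint cosrep (k l : nat) : G :=
  if l is l'.+1 then rh (k + l') * cosrep k l' else 1.

Lemma cosrep_act k l : k + l <= m -> act (cosrep k l) (inord k) = inord (k + l).
Proof.
elim: l => [|l IH] klm; first by rewrite act1 addn0.
by rewrite actM IH ?addnS ?act_rhL //; lia.
Qed.

Lemma cosrep_gen k l : k + l <= m -> gen k (cosrep k l).
Proof.
elim: l => [|l IH] klm; first exact: gen1.
by apply: gen_rh; [lia|apply: IH; lia].
Qed.

Lemma cosrepC k l i : k + l < i -> i < m -> commute (rh i) (cosrep k l).
Proof.
move=> kli im; elim: l kli => [|l IH] kli; first exact: commute1.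
by apply: commuteM; [apply: rhC; rewrite /far; lia|apply: IH; lia].
Qed.

(** The letters of [cosrep k l] have decreasing indices. [rh i] commutes with those above i+1, the
    braid relation turns it into [rh i.+1] on the far side of the letters i+1 and i, and this
    commutes with all the letters below i. *)
Lemma cosrep_shift k l i : k + l <= m -> k <= i -> i.+1 < k + l ->
  rh i * cosrep k l = cosrep k l * rh i.+1.
Proof.
elim: l => [|l IH] klm ki il; first lia.
have [il1|il1] := ltnP i.+1 (k + l).
  rewrite [cosrep _ _]/= -mulgA -IH //; last lia.
  by rewrite !mulgA rhC // /far; lia.
have {}il : i.+1 = k + l by lia.
case: l il klm {IH il1} => [|l] il klm; first lia.
have {il} -> : i = k + l by lia.
rewrite /= addnS !mulgA rh_braid -?mulgA; last lia.
by rewrite cosrepC //; lia.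
Qed.

(** The top letter of the representative has index k+l-1. A smaller i is shifted through, an equal
    one cancels the letter, i = k+l lengthens the representative, and a larger i commutes with all
    of it. *)
Lemma cosrep_rh k l i : k + l <= m -> k <= i < m ->
  exists2 l', k + l' <= m & exists2 y, gen k.+1 y &
    rh i * cosrep k l = cosrep k l' * y.
Proof.
move=> klm /andP[ki im].
have [ikl|ikl|ikl] := ltngtP i (k + l).
- have [ikl1|ikl1] := ltnP i.+1 (k + l).
    exists l => //; exists (rh i.+1); last exact: cosrep_shift.
    by apply: gen_rh1; lia.
  case: l klm ikl ikl1 => [|l] klm ikl ikl1; first lia.
  exists l; first lia; exists 1; first exact: gen1.
  have -> : i = k + l by lia.
  by rewrite /= mulgA rhK ?mul1g ?mulg1 //; lia.
- exists l => //; exists (rh i); first by apply: gen_rh1; lia.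
  exact: cosrepC.
- exists l.+1; first lia; exists 1; first exact: gen1.
  by rewrite /= ikl mulg1.
Qed.

Lemma gen_cosrep k x : k <= m -> gen k x ->
  exists2 l, k + l <= m & exists2 y, gen k.+1 y & x = cosrep k l * y.
Proof.
move=> km; elim=> [|i z ki _ [l klm [y gy ->]]].
  by exists 0; rewrite ?addn0 //; exists 1; [exact: gen1|rewrite mulg1].
have [l' kl'm [y' gy' E]] := cosrep_rh klm ki.
by exists l' => //; exists (y' * y); [exact: genM|rewrite mulgA E mulgA].
Qed.

(** In the decomposition of x, the factor from [gen k.+1] fixes the point k and the representative
    sends k to k+l, so l = 0. From k = m on, [gen k] is trivial, hence the guard on the
    assumption. *)
Lemma gen_stab k x :
  (k < m -> act x (inord k) = inord k) -> gen k x -> gen k.+1 x.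
Proof.
move=> fixk gx; have [mk|km] := leqP m k.
  by rewrite (gen_ge mk gx); apply: gen1.
have [[|l] klm [y gy xE]] := gen_cosrep (ltnW km) gx; first by rewrite xE mul1g.
have /eqP := fixk km; rewrite xE actM (gen_fix gy) ?cosrep_act // 1?ltnW //.
by rewrite inord_eq //; lia.
Qed.

Lemma gen_faithful x : gen 0 x -> act x =1 id -> x = 1.
Proof.
move=> gx xid; suff : forall k, gen k x by move/(_ m)/gen_ge; apply.
by elim=> // k; apply: gen_stab => _; rewrite xid.
Qed.

(** Induction on the number k of final points not known to be fixed: composing with the inverse of a
    suitable coset representative makes one more point fixed. *)
Lemma gen_surj (s : 'S_m.+1) : exists2 x, gen 0 x & (f x).2 = s.
Proof.
suff H k (t : 'S_m.+1) : k <= m.+1 ->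
    (forall j, j < m.+1 - k -> t (inord j) = inord j) ->
    exists2 x, gen 0 x & (f x).2 = t.
  by apply: (H m.+1) => // j; rewrite subnn.
elim: k t => [|k IH] t km fixt.
  exists 1; [exact: gen1|rewrite gmulf1; apply/permP => i; rewrite perm1].
  by rewrite -[i]inord_val fixt // subn0.
set j := m - k; have jm : j <= m by rewrite leq_subr.
have fixj i : i < j -> t (inord i) = inord i by move=> ij; apply: fixt; lia.
(* The values below [j] are already taken by the fixed points. *)
have jt : j <= t (inord j).
  rewrite leqNgt; apply/negP => tj; have := fixj _ tj.
  by rewrite inord_val => /perm_inj /(congr1 val) /=; rewrite inordK //; lia.
pose l := t (inord j) - j; pose d := cosrep j l.
have jlm : j + l <= m by have := ltn_ord (t (inord j)); lia.
have tj : t (inord j) = act d (inord j).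
  by rewrite cosrep_act // subnKC // inord_val.
have [i ij|x gx xE] := IH (t * (f d^-1).2) (ltnW km).
  rewrite permM -[LHS]/(act d^-1 _).
  have [->|{}ij] : i = j \/ i < j by lia.
    by rewrite tj actK.
  by rewrite fixj // (gen_fix (genV (cosrep_gen jlm))) //; lia.
exists (d * x); first by apply: genM => //; apply: gen_sub (cosrep_gen jlm).
by rewrite gmulfM /= xE gmulfV mulgKV.
Qed.

(** * Realising prescribed images of the first points by a product of rho's *)

Lemma uniq_size (t : seq 'I_m.+1) : uniq t -> size t <= m.+1.
Proof. by move/card_uniqP <-; rewrite -[X in _ <= X]card_ord max_card. Qed.

Lemma perm_extends (t : seq 'I_m.+1) : uniq t ->
  exists s : 'S_m.+1, forall i, i < size t -> s (inord i) = nth ord0 t i.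
Proof.
elim/last_ind: t => [|t x IH]; first by exists 1.
rewrite rcons_uniq => /andP[xt ut]; have [s sE] := IH ut.
have tm : size t < m.+1.
  by rewrite -(size_rcons t x) uniq_size // rcons_uniq xt.
rewrite size_rcons.
(* The transposition corrects the image of the next point. It leaves the earlier images alone: they
   differ from [x] by uniqueness and from [s (inord (size t))] by injectivity. *)
exists (s * tperm (s (inord (size t))) x) => i.
rewrite ltnS leq_eqVlt permM nth_rcons.
case/predU1P => [->|it]; first by rewrite tpermL ltnn eqxx.
rewrite it (sE i it) tpermD //; last first.
  by apply: contraNneq xt => ->; apply: mem_nth.
by rewrite -(sE i it) (inj_eq perm_inj) inord_eq //; lia.
Qed.

Lemma gen_extends (t : seq 'I_m.+1) : uniq t ->
  exists2 h, gen 0 h & forall i, i < size t -> act h (inord i) = nth ord0 t i.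
Proof.
case/perm_extends => s sE; have [h gh hs] := gen_surj s.
by exists h; rewrite // /act hs.
Qed.

(** * The conjugates of alpha and their relations *)

Definition alpha (i : nat) : G := sg i * rh i.

Let o0 : 'I_m.+1 := inord 0.
Let o1 : 'I_m.+1 := inord 1.

Lemma gen2_alpha x : gen 2 x -> commute (alpha 0) x.
Proof.
elim=> [|i y i2 _ IH]; first exact: commute1.
apply: commuteM => //; apply/commute_sym/commuteM.
  by apply/commute_sym/sg_rhC; rewrite ?/far; lia.
by apply: rhC; rewrite ?/far; lia.
Qed.

(* alpha_{i,j}; the value at i = j is junk. *)
Definition X (i j : 'I_m.+1) : G :=
  if pselect (exists h, gen 0 h /\ (act h o0 = i /\ act h o1 = j)) is left e
  then alpha 0 ^ (projT1 (cid e))^-1 else 1.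

(** Independence of the choice of h: if k gives the same two images, then [h^-1 * k] fixes the first
    two points, so it lies in [gen 2] and commutes with [alpha 0]. *)
Lemma X_act h : gen 0 h -> X (act h o0) (act h o1) = alpha 0 ^ h^-1.
Proof.
move=> gh; rewrite /X; case: pselect => [e|[]]; last by exists h.
case: cid => k /= [gk [k0 k1]].
have C : commute (alpha 0) (h^-1 * k).
  apply/gen2_alpha/gen_stab => [_|]; first by rewrite actM k1 actK.
  apply: gen_stab => [_|]; first by rewrite actM k0 actK.
  by apply: genM => //; apply: genV.
have {1}<- : alpha 0 ^ (h^-1 * k) = alpha 0 by rewrite /conjg C mulKg.
by rewrite conjgM conjgK.
Qed.

Lemma X_rep i j : i != j ->
  exists2 h, gen 0 h & act h o0 = i /\ act h o1 = j.
Proof.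
move=> ij; have [|h gh hE] := @gen_extends [:: i; j].
  by rewrite /= inE ij.
by exists h => //; rewrite !hE.
Qed.

Lemma X_conj h i j : gen 0 h -> i != j -> X (act h i) (act h j) = X i j ^ h^-1.
Proof.
move=> gh /X_rep[k gk [<- <-]].
by rewrite -!actM !X_act //; [rewrite invgM conjgM|apply: genM].
Qed.

(** [rh i * rh i.+1] carries the points i, i+1 to i+1, i+2, and by the mixed and braid relations it
    conjugates [alpha i] to [alpha i.+1]. *)
Lemma alpha_X i : i < m -> alpha i = X (inord i) (inord i.+1).
Proof.
elim: i => [|i IH] im.
  rewrite -[inord 0]act1 -[inord 1 in RHS]act1 X_act ?invg1 ?conjg1 //.
  exact: gen1.
have gh : gen 0 (rh i * rh i.+1) by apply/genM; apply: gen_rh1; lia.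
have -> : inord i.+1 = act (rh i * rh i.+1) (inord i).
  by rewrite actM act_rhD ?act_rhL //; lia.
have -> : inord i.+2 = act (rh i * rh i.+1) (inord i.+1).
  by rewrite actM act_rhL ?act_rhD //; lia.
rewrite X_conj // ?inord_eq -?IH; try lia.
rewrite /conjg invgK mulgA; apply: (mulIg (rh i * rh i.+1)).
rewrite mulgVK /alpha -[LHS]mulgA (mulgA (rh i.+1)) -rh_braid //.
by rewrite !mulgA mixed.
Qed.

(** Replacing h by [h * rh 0] swaps the two points, and conjugation by [rh 0] turns [sg 0 * rh 0]
    into [rh 0 * sg 0], its inverse since both factors are involutions. *)
Lemma X_sym i j : i != j -> X j i = (X i j)^-1.
Proof.
move=> ij; have m0 : 0 < m by apply: (@uniq_size [:: i; j]); rewrite /= inE ij.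
have [h gh [<- <-]] := X_rep ij.
transitivity (X (act (h * rh 0) o0) (act (h * rh 0) o1)).
  by rewrite !actM act_rhL ?act_rhR.
rewrite !X_act //; last by apply/genM/gen_rh1.
rewrite invgM conjgM -conjVg; congr (_ ^ _).
rewrite /conjg invgK /alpha rhV // -mulgA rhK // mulg1 invgM rhV //.
by rewrite (mulg1_eq (sgK m0)).
Qed.

Lemma commuteJ (x y h : G) : commute x y -> commute (x ^ h) (y ^ h).
Proof. by rewrite /commute -!conjMg => ->. Qed.

(* This is the relation F1, rewritten in terms of the alpha_{i,j}. *)
Lemma X_commR i j k : i != k -> j != k -> commute (X i k) (X j k).
Proof.
have [->|ij ik jk] := eqVneq i j; first by move=> _ _; apply: commute_refl.
have ut : uniq [:: i; j; k] by rewrite /= !inE negb_or ij ik jk.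
have m1 : 1 < m := uniq_size ut; have m0 : 0 < m := ltnW m1.
have [h gh hE] := gen_extends ut.
rewrite -[i](hE 0) // -[j](hE 1%N) // -[k](hE 2) //.
rewrite !X_conj ?inord_eq //; apply: commuteJ.
have -> : X (inord 0) (inord 2) = alpha 1 ^ (rh 0).
  rewrite -(act_rhR m0) -[inord 2](@act_rhD 0) //.
  by rewrite X_conj ?inord_eq -?alpha_X ?rhV //; apply: gen_rh1.
rewrite -alpha_X // /commute /conjg rhV //;
(* The mixed relation expresses [sg 0] through [sg 1]. Substituted into F1 and multiplied on the
   right by [rh 0 * rh 1 * rh 0], it leaves exactly the commutation of [alpha 1] with its conjugate
   by [rh 0]. *)
have sg0E : sg 0 = rh 1 * (rh 0 * (sg 1 * rh 0 * rh 1)).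
  by rewrite -mixed // -!mulgA !rhKl.
have := congr1 (fun x => x * (rh 0 * rh 1 * rh 0)) (forbidden m1).
rewrite {1}rh_braid // sg0E /alpha -!mulgA.
by rewrite !rhKl.
Qed.

(** A shared index is brought to second place in both factors by [X_sym], at the cost of inverses,
    and [X_commR] applies. Four distinct indices are transported to 0, 1, 2, 3, where all letters of
    [alpha 0] and [alpha 2] are far apart. *)
Lemma X_comm i j k l : i != j -> k != l -> commute (X i j) (X k l).
Proof.
move=> ij kl.
have [jl|jl] := eqVneq j l; first by rewrite -jl in kl *; apply: X_commR.
have [jk|jk] := eqVneq j k.
  rewrite (X_sym (i := l)) 1?eq_sym //; apply/commuteV; rewrite -jk.
  by apply: X_commR; rewrite // jk eq_sym.
have [il|il] := eqVneq i l.
  rewrite (X_sym (i := j)) 1?eq_sym //; apply/commute_sym/commuteV.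
  by rewrite il; apply: X_commR.
have [ik|ik] := eqVneq i k.
  rewrite (X_sym (i := j)) 1?eq_sym // (X_sym (i := l)) 1?eq_sym //.
  apply/commute_sym/commuteV/commute_sym/commuteV; rewrite ik.
  by apply: X_commR; rewrite -?ik eq_sym // ik.
have ut : uniq [:: i; j; k; l] by rewrite /= !inE !negb_or ij ik il jk jl kl.
have m2 : 2 < m := uniq_size ut; have [h gh hE] := gen_extends ut.
rewrite -[i](hE 0) // -[j](hE 1%N) // -[k](hE 2) // -[l](hE 3) //.
rewrite !X_conj ?inord_eq -?alpha_X //; try lia; apply: commuteJ.
rewrite /alpha; apply: commuteM; apply/commute_sym/commuteM.
- by apply: sgC; rewrite ?/far; lia.
- by apply: sg_rhC; rewrite ?/far; lia.
- by apply/commute_sym/sg_rhC; rewrite ?/far; lia.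
- by apply: rhC; rewrite ?/far; lia.
Qed.

Lemma f_X i j : i != j -> f (X i j) = (xgen i j, 1).
Proof.
move=> ij; have m0 : 0 < m by apply: (@uniq_size [:: i; j]); rewrite /= inE ij.
have [h gh [<- <-]] := X_rep ij.
have fh : f h = (0%R, (f h).2) by rewrite [LHS]surjective_pairing gen_f.
rewrite X_act // /alpha gmulfJ gmulfM f_sg // f_rh // gmulfV fh.
rewrite /conjg invgK; congr (_, _) => /=.
  by rewrite tperm2 !xact0 oppr0 xact0 !addr0 add0r xact_gen.
by rewrite tperm2 mulg1 mulVg.
Qed.

(** * Integer powers, monomials and the normal form *)

Definition zpow (x : G) (k : int) : G :=
  match k with Posz k => x ^+ k | Negz k => x^-1 ^+ k.+1 end.

Lemma zpowD1 x k : zpow x (k + 1) = x * zpow x k.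
Proof.
case: k => [k|[|k]]; first by rewrite addrC /= expgS.
  by rewrite /= mulgV.
have -> : (Negz k.+1 + 1 = Negz k)%R by lia.
by rewrite /= [in RHS]expgS mulKVg.
Qed.

Lemma commute_zpow x y k : commute x y -> commute x (zpow y k).
Proof. by move=> xy; case: k => k; apply: commuteX => //; apply: commuteV. Qed.

Lemma f_zpow x v k : f x = (v, 1) -> f (zpow x k) = ((v *~ k)%R, 1).
Proof.
move=> fx; have fX j : f (x ^+ j) = ((v *+ j)%R, 1).
  elim: j => [|j IH]; first by rewrite gmulf1.
  by rewrite expgS gmulfM fx IH; congr (_, _); rewrite /= ?xact1 ?mulrS ?mulg1.
case: k => k; first exact: fX.
by rewrite /zpow expVgn gmulfV fX; congr (_, _); rewrite /= invg1 ?xact1.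
Qed.

(** The product is noncommutative: the new factor x reaches the front because it commutes with every
    factor it passes. *)
Lemma commute_prod_update (I : eqType) (r : seq I) (F F' : I -> G) x i0 :
  uniq r -> i0 \in r -> (forall i, i != i0 -> F' i = F i) -> F' i0 = x * F i0 ->
  (forall i, commute x (F i)) -> \prod_(i <- r) F' i = x * \prod_(i <- r) F i.
Proof.
move=> + + F'E F'i0 xF; elim: r => // i r IH /= /andP[ir ur].
rewrite inE !big_cons; case: eqVneq ir => [<- i0r _|ii0 _ /= i0r].
  rewrite F'i0 mulgA; congr (_ * _); apply: eq_big_seq => j jr.
  by apply: F'E; apply: contraNneq i0r => <-.
by rewrite IH // F'E 1?eq_sym // !mulgA xF.
Qed.

Lemma pairs_neq (p : pairs m.+1) : (val p).1 != (val p).2.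
Proof. by case: p => -[i j] /= ij; rewrite neq_ltn ij. Qed.

Definition Xprod (v : Zpairs m.+1) : G :=
  \prod_(p : pairs m.+1) zpow (X (val p).1 (val p).2) (v p).

Lemma f_Xprod v : f (Xprod v) = (v, 1).
Proof.
(* [xact 1 v] unfolds to the sum of the basis elements weighted by v, which matches [Xprod v] factor
   by factor. *)
transitivity ((xact 1 v, 1) : ZS m.+1); last by rewrite xact1.
rewrite /Xprod /xact; elim: (index_enum _) => [|p r IH].
  by rewrite !big_nil gmulf1.
rewrite !big_cons gmulfM IH (f_zpow _ (f_X (pairs_neq p))).
by congr (_, _); rewrite /= ?xact1 ?mulg1 ?perm1.
Qed.

Lemma XprodD (p : pairs m.+1) v :
  Xprod (v + xbasis (val p).1 (val p).2) = X (val p).1 (val p).2 * Xprod v.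
Proof.
apply: (commute_prod_update (i0 := p));
  rewrite ?index_enum_uniq ?mem_index_enum //.
- move=> q qp; rewrite !ffunE -surjective_pairing val_eqE (negbTE qp).
  by rewrite addr0.
- by rewrite !ffunE -surjective_pairing eqxx zpowD1.
- by move=> q; apply/commute_zpow/X_comm; apply: pairs_neq.
Qed.

(** All ordered pairs are allowed, so inverses are covered: [X j i] is the inverse of [X i j]. *)
Inductive pure : G -> Prop :=
| pure1 : pure 1
| pure_X i j x : i != j -> pure x -> pure (X i j * x).

Lemma pure_Xprod x : pure x -> exists v, x = Xprod v.
Proof.
elim=> [|i j y ij _ [v ->]].
  by exists 0%R; rewrite /Xprod big1 // => p _; rewrite ffunE.
have [lij|lji|/val_inj ijE] := ltngtP i j; last by rewrite ijE eqxx in ij.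
  by exists (v + xbasis i j)%R; rewrite (XprodD (Sub (i, j) lij)).
exists (v - xbasis j i)%R; apply: (mulgI (X j i)).
rewrite -(XprodD (Sub (j, i) lji)) /= subrK.
by rewrite (X_sym ij) mulKg.
Qed.

Lemma pureJ x h : pure x -> gen 0 h -> pure (x ^ h^-1).
Proof.
move=> + gh; elim=> [|i j y ij _ IH]; first by rewrite conj1g; apply: pure1.
by rewrite conjMg -X_conj //; apply: pure_X; rewrite // (can_eq (actK h)).
Qed.

Lemma pure_gen x : exists2 a, pure a & exists2 h, gen 0 h & x = a * h.
Proof.
have step i a h : i < m -> pure a -> gen 0 h ->
    exists2 a', pure a' & exists2 h', gen 0 h' & rh i * (a * h) = a' * h'.
  move=> im pa gh; exists (a ^ (rh i)^-1); first by apply/pureJ/gen_rh1.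
  exists (rh i * h); first exact: gen_rh.
  by rewrite !mulgA -conjgCV.
elim/generated: x => [|i x im [a pa [h gh ->]]|i x im [a pa [h gh ->]]].
- by exists 1; [exact: pure1|exists 1; [exact: gen1|rewrite mulg1]].
- exact: step.
(* Since [sg i] equals [alpha i * rh i], the rho case is applied first and the pure factor [alpha i]
   is put in front. *)
have [a' pa' [h' gh' E]] := step i a h im pa gh.
exists (alpha i * a').
  by rewrite alpha_X //; apply: pure_X; rewrite ?inord_eq //; lia.
by exists h'; rewrite // -mulgA -E /alpha -mulgA rhKl.
Qed.

Lemma presentation_bij : bijective f.
Proof.
have f_surj a : exists x, f x = a.
  case: a => v s; have [h gh hs] := gen_surj s.
  exists (Xprod v * h); rewrite gmulfM f_Xprod.
  by congr (_, _); rewrite /= ?gen_f ?xact0 ?addr0 ?hs ?mulg1.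
have f_inj : injective f.
  apply: gmulf_inj => x; have [a /pure_Xprod[v ->] [h gh ->]] := pure_gen x.
  rewrite gmulfM f_Xprod => E.
  have /= := congr1 fst E; rewrite gen_f // xact0 addr0 => ->.
  have /= := congr1 snd E; rewrite mulg1 => hs.
  rewrite (gen_faithful gh) ?mulg1; last by move=> i; rewrite /act hs perm1.
  by rewrite /Xprod big1 // => p _; rewrite ffunE.
exists (fun a => projT1 (cid (f_surj a))) => [x|a]; last by case: cid.
by apply: f_inj; case: cid.
Qed.

End Presentation.

(** * Universal properties of quotients and of free groups *)

Lemma mquo_lift (M N : monoidType) (R : M -> M -> Prop) (phi : M -> N) :
    {morph phi : x y / x * y} -> (forall x y, R x y -> phi x = phi y) ->
  exists2 psi : mquo R -> N, {morph psi : a b / a * b} &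
    forall x, psi (mquo_pi R x) = phi x.
Proof.
move=> phiM phiR.
have phi_cong x y : cong R x y -> phi x = phi y.
  elim=> // {x y} [x y z _ -> _ ->//|x x' y y' _ Ex _ Ey].
  by rewrite !phiM Ex Ey.
exists (fun a => phi (mquo_repr a)) => [a b|x]; last exact/phi_cong/mquo_piK.
by rewrite -phiM; apply/phi_cong/mquo_piK.
Qed.

Lemma free_group_lift (T : choiceType) (H : groupType) (phi : T -> H) :
  exists2 psi : free_group T -> H, {morph psi : a b / a * b} &
    forall t, psi (free_gen t) = phi t.
Proof.
pose letter (l : T * bool) := if l.2 then (phi l.1)^-1 else phi l.1.
have [|_ _ []|psi psiM psiE] := @mquo_lift (word T) H (@cancel_rel T)
    (fun w => \prod_(l <- w) letter l).
- by move=> u v; rewrite big_cat.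
- move=> [t []]; rewrite !big_cons !big_nil /letter /= mulg1.
    by rewrite mulVg.
  by rewrite mulgV.
by exists psi => // t; rewrite psiE big_seq1.
Qed.

(** * The defining relations inside the semidirect product *)

Section Target.
Variable n : nat.
Implicit Types (a b c d : 'I_n) (s t : 'S_n) (v w : Zpairs n).

Local Notation zs v s := ((v, s) : ZS n).

Lemma ZS_commute v w s t : xact s w = w -> xact t v = v -> commute s t ->
  commute (zs v s) (zs w t).
Proof.
by move=> sw tv st; congr (_, _); rewrite /= ?sw ?tv 1?addrC // -st.
Qed.

Lemma tperm_disjointC a b c d : uniq [:: a; b; c; d] ->
  commute (tperm a b) (tperm c d).
Proof.
rewrite /= !inE !negb_or => /and4P[/and3P[_ ac ad] /andP[bc bd] _ _].
by apply/commgP/conjg_fixP; rewrite tpermJ !tpermD // eq_sym.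
Qed.

Lemma tperm_braid a b c : uniq [:: a; b; c] ->
  tperm a b * tperm b c * tperm a b = tperm b c * tperm a b * tperm b c.
Proof.
rewrite /= !inE !negb_or => /and3P[/andP[ab ac] bc _].
(* Transpositions being involutions, both sides are conjugates, equal to the transposition of a and
   c. *)
rewrite -{1}[tperm a b]tpermV -{2}[tperm b c]tpermV.
rewrite -!mulgA -!/(conjg _ _) !tpermJ.
by rewrite tpermR tpermL !tpermD // 1?eq_sym // tpermC.
Qed.

Section Triple.
Variables a b c : 'I_n.
Hypothesis abc : uniq [:: a; b; c].

Let triple_tpermE : ((tperm a b c = c) * (tperm b c a = a))%type.
Proof.
move: abc; rewrite /= !inE !negb_or => /and3P[/andP[ab ac] bc _].
by rewrite !tpermD // eq_sym.
Qed.

Let triE := (xact_gen, permM, tpermL, tpermR, triple_tpermE).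

(** Both sides have the vector x_{a,b} + x_{a,c} + x_{b,c}. *)
Lemma ZS_braid : let x := zs (xgen a b) (tperm a b) in
  let y := zs (xgen b c) (tperm b c) in x * y * x = y * x * y.
Proof.
congr (_, _); rewrite /= ?mulgA -?tperm_braid // !triE.
by rewrite addrC [X in (_ + X)%R = _]addrC addrA.
Qed.

Lemma ZS_rho_braid : let x := zs 0%R (tperm a b) in
  let y := zs 0%R (tperm b c) in x * y * x = y * x * y.
Proof.
by congr (_, _); rewrite /= ?mulgA -?tperm_braid // !xact0 !addr0.
Qed.

Lemma ZS_mixed : let x := zs 0%R (tperm a b) in
  let y := zs 0%R (tperm b c) in
  x * y * zs (xgen a b) (tperm a b) = zs (xgen b c) (tperm b c) * x * y.
Proof.
by congr (_, _); rewrite /= ?mulgA -?tperm_braid // !xact0 !triE !addr0 ?add0r.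
Qed.

(** Both sides have the vector x_{a,c} + x_{b,c}. *)
Lemma ZS_forbidden : let x := zs (xgen a b) (tperm a b) in
  let y := zs (xgen b c) (tperm b c) in
  zs 0%R (tperm a b) * y * x = y * x * zs 0%R (tperm b c).
Proof.
congr (_, _); rewrite /= ?mulgA -?tperm_braid // !xact0 !triE addr0 add0r.
by rewrite addrC.
Qed.

End Triple.

Lemma ZS_invol a b : let x := zs (xgen a b) (tperm a b) in x * x = 1.
Proof.
by congr (_, _); rewrite /= ?tperm2 // xact_gen tpermL tpermR xgenN addNr.
Qed.
End Target.

Lemma mquo_piM (M : monoidType) (R : M -> M -> Prop) :
  {morph mquo_pi R : x y / x * y}.
Proof. by move=> x y; rewrite -mquo_mulE. Qed.

Lemma mquo_pi_rel (M : monoidType) (R : M -> M -> Prop) x y :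
  R x y -> mquo_pi R x = mquo_pi R y.
Proof. by move=> xy; apply/mquo_piP/cong_base. Qed.

Lemma morphM_1 (G H : groupType) (g : G -> H) :
  {morph g : x y / x * y} -> g 1 = 1.
Proof. by move=> gM; apply: (mulgI (g 1)); rewrite -gM !mulg1. Qed.

(** * Relations, generation and universal property of the flat welded braid group *)

Section FlatWelded.
Variable m : nat.
Local Notation n := m.+1.

Let mod_WB : WB n -> FWB n := @gquo_pi (WB n) (@FWB_rel n).
Let mod_VB (x : VB n) : FWB n := mod_WB (@gquo_pi (VB n) (@WB_rel n) x).
Let mod_free (x : free_group (vb_gen n)) : FWB n :=
  mod_VB (@gquo_pi (free_group (vb_gen n)) (@VB_rel n) x).

Let mod_WBM : {morph mod_WB : x y / x * y}.
Proof. exact: mquo_piM. Qed.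

Let mod_VBM : {morph mod_VB : x y / x * y}.
Proof.
by move=> x y; rewrite /mod_VB -mod_WBM; congr mod_WB; apply: mquo_piM.
Qed.

Let mod_freeM : {morph mod_free : x y / x * y}.
Proof.
by move=> x y; rewrite /mod_free -mod_VBM; congr mod_VB; apply: mquo_piM.
Qed.

Let mod_free_rel x y : VB_rel x y -> mod_free x = mod_free y.
Proof. by move=> xy; congr mod_VB; apply: mquo_pi_rel. Qed.

Let mod_VB_rel x y : WB_rel x y -> mod_VB x = mod_VB y.
Proof. by move=> xy; congr mod_WB; apply: mquo_pi_rel. Qed.

Let mod_WB_rel x y : FWB_rel x y -> mod_WB x = mod_WB y.
Proof. exact: mquo_pi_rel. Qed.

(** Indexing by [nat], with value 1 out of range, lets i and i+1 be used without ordinal casts. *)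
Definition FWB_sg (i : nat) : FWB n :=
  if insub i is Some j then mod_free (@fg_sg n j) else 1.
Definition FWB_rh (i : nat) : FWB n :=
  if insub i is Some j then mod_free (@fg_rh n j) else 1.

Let sgE (i : 'I_m) : FWB_sg i = mod_free (@fg_sg n i).
Proof.
rewrite /FWB_sg insubT //= => im.
by congr (mod_free (@fg_sg n _)); apply: val_inj.
Qed.

Let rhE (i : 'I_m) : FWB_rh i = mod_free (@fg_rh n i).
Proof.
rewrite /FWB_rh insubT //= => im.
by congr (mod_free (@fg_rh n _)); apply: val_inj.
Qed.

Lemma FWB_rh_braid i : i.+1 < m ->
  FWB_rh i * FWB_rh i.+1 * FWB_rh i = FWB_rh i.+1 * FWB_rh i * FWB_rh i.+1.
Proof.
move=> im; have := @VB_R3 n (Ordinal (ltnW im)) (Ordinal im) erefl.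
by move/mod_free_rel; rewrite !mod_freeM -!rhE.
Qed.

Lemma FWB_rhC i j : i < m -> j < m -> far i j -> commute (FWB_rh i) (FWB_rh j).
Proof.
move=> im jm /(@VB_R4 n (Ordinal im) (Ordinal jm)) /mod_free_rel.
by rewrite !mod_freeM -!rhE.
Qed.

Lemma FWB_sgC i j : i < m -> j < m -> far i j -> commute (FWB_sg i) (FWB_sg j).
Proof.
move=> im jm /(@VB_R2 n (Ordinal im) (Ordinal jm)) /mod_free_rel.
by rewrite !mod_freeM -!sgE.
Qed.

Lemma FWB_sg_rhC i j : i < m -> j < m -> far i j ->
  commute (FWB_sg i) (FWB_rh j).
Proof.
move=> im jm /(@VB_R6 n (Ordinal im) (Ordinal jm)) /mod_free_rel.
by rewrite !mod_freeM -sgE -rhE.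
Qed.

Lemma FWB_mixed i : i.+1 < m ->
  FWB_rh i * FWB_rh i.+1 * FWB_sg i = FWB_sg i.+1 * FWB_rh i * FWB_rh i.+1.
Proof.
move=> im; have := @VB_M n (Ordinal (ltnW im)) (Ordinal im) erefl.
by move/mod_free_rel; rewrite !mod_freeM -!rhE -!sgE.
Qed.

Let mod_free1 : mod_free 1 = 1.
Proof. exact: morphM_1 mod_freeM. Qed.

Lemma FWB_rhK i : i < m -> FWB_rh i * FWB_rh i = 1.
Proof.
move=> im; have /mod_free_rel := @VB_R5 n (Ordinal im).
by rewrite expg2 mod_freeM -!rhE mod_free1.
Qed.

Lemma FWB_forbidden i : i.+1 < m ->
  FWB_rh i * FWB_sg i.+1 * FWB_sg i = FWB_sg i.+1 * FWB_sg i * FWB_rh i.+1.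
Proof.
move=> im; have := @WB_F1 n (Ordinal (ltnW im)) (Ordinal im) erefl.
by move/mod_VB_rel; rewrite !mod_VBM -!/(mod_free _) -!rhE -!sgE.
Qed.

Lemma FWB_sgK i : i < m -> FWB_sg i * FWB_sg i = 1.
Proof.
move=> im; have /mod_WB_rel := @FWB_sq n (Ordinal im).
rewrite expg2 mod_WBM -!/(mod_VB _) -!/(mod_free _) -!sgE => ->.
exact: morphM_1 mod_WBM.
Qed.

Lemma FWB_generated (P : FWB n -> Prop) : P 1 ->
  (forall i x, i < m -> P x -> P (FWB_rh i * x)) ->
  (forall i x, i < m -> P x -> P (FWB_sg i * x)) -> forall x, P x.
Proof.
move=> P1 Prh Psg x.
pose mod_word (w : word (vb_gen n)) :=
  mod_free (mquo_pi (@cancel_rel (vb_gen n)) w).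
have mod_wordM u v : mod_word (u ++ v) = mod_word u * mod_word v.
  by rewrite -mod_freeM -mquo_piM.
have [w ->] : exists w, x = mod_word w.
  (* One representative for each layer: in [WB], in [VB], in the free group, and finally a word. *)
  exists (mquo_repr (mquo_repr (mquo_repr (mquo_repr x)))).
  by rewrite /mod_word /mod_free /mod_VB /mod_WB /gquo_pi !mquo_reprK.
pose letter l := mod_word [:: l].
have letterV t : letter (t, true) = (letter (t, false))^-1.
  apply/esym/mulg1_eq; rewrite -mod_wordM -[RHS]mod_free1.
  by congr mod_free; apply: mquo_pi_rel (Cancel (t, false)).
elim: w => [|l w IH]; first by rewrite [mod_word _]mod_free1.
rewrite -cat1s mod_wordM -/(letter l).
have letter_sg (i : 'I_m) b : letter (inl i, b) = FWB_sg i.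
  have E : letter (inl i, false) = FWB_sg i by rewrite sgE.
  by case: b; rewrite // letterV E; apply/mulg1_eq/FWB_sgK.
have letter_rh (i : 'I_m) b : letter (inr i, b) = FWB_rh i.
  have E : letter (inr i, false) = FWB_rh i by rewrite rhE.
  by case: b; rewrite // letterV E; apply/mulg1_eq/FWB_rhK.
by case: l => [[i|i] b]; rewrite ?letter_sg ?letter_rh; [apply: Psg|apply: Prh].
Qed.

(** The map descends from the free group through [VB] and [WB] to [FWB], each relation being checked
    at the layer where it is imposed. *)
Lemma FWB_lift (H : groupType) (s r : nat -> H) :
    (forall i, i.+1 < m -> s i * s i.+1 * s i = s i.+1 * s i * s i.+1) ->
    (forall i j, i < m -> j < m -> far i j -> commute (s i) (s j)) ->
    (forall i, i.+1 < m -> r i * r i.+1 * r i = r i.+1 * r i * r i.+1) ->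
    (forall i j, i < m -> j < m -> far i j -> commute (r i) (r j)) ->
    (forall i, i < m -> r i * r i = 1) ->
    (forall i j, i < m -> j < m -> far i j -> commute (s i) (r j)) ->
    (forall i, i.+1 < m -> r i * r i.+1 * s i = s i.+1 * r i * r i.+1) ->
    (forall i, i.+1 < m -> r i * s i.+1 * s i = s i.+1 * s i * r i.+1) ->
    (forall i, i < m -> s i * s i = 1) ->
  exists f : UMagmaMorphism.type (FWB n) H,
    forall i, i < m -> f (FWB_sg i) = s i /\ f (FWB_rh i) = r i.
Proof.
move=> R1 R2 R3 R4 R5 R6 M F1 S2.
pose phi (t : vb_gen n) := match t with inl i => s i | inr i => r i end.
have [f0 f0M f0E] := free_group_lift phi.
have f0_sg (i : 'I_n.-1) : f0 (fg_sg i) = s i by apply: f0E.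
have f0_rh (i : 'I_n.-1) : f0 (fg_rh i) = r i by apply: f0E.
have f01 : f0 1 = 1 by exact: morphM_1 f0M.
have [x y|f1 f1M f1E] := @mquo_lift _ _ (@VB_rel n) _ f0M.
  by case=> [i j ij|i j ij|i j ij|i j ij|i|i j ij|i j ij];
    rewrite ?expg2 ?f0M ?f01 ?f0_sg ?f0_rh ?ij;
    do ?[exact: R2|exact: R4|exact: R5|exact: R6];
    move: (ltn_ord j); rewrite ij => jm;
    [apply: R1|apply: R3|apply: M].
have f1_sg (i : 'I_n.-1) : f1 (VB_sg i) = s i by rewrite f1E.
have f1_rh (i : 'I_n.-1) : f1 (VB_rh i) = r i by rewrite f1E.
have [x y|f2 f2M f2E] := @mquo_lift (VB n) _ (@WB_rel n) _ f1M.
  case=> i j ij; rewrite !f1M !f1_sg !f1_rh ij; apply: F1.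
  by rewrite -ij.
have f2_sg (i : 'I_n.-1) : f2 (WB_sg i) = s i by rewrite f2E.
have f21 : f2 1 = 1 by exact: (@morphM_1 (WB n)) f2M.
have [x y|f3 f3M f3E] := @mquo_lift (WB n) _ (@FWB_rel n) _ f2M.
  by case=> i; rewrite expg2 f2M f21 f2_sg S2.
have f31 : f3 1 = 1 by exact: (@morphM_1 (FWB n)) f3M.
pose F : UMagmaMorphism.type (FWB n) H :=
  HB.pack (f3 : FWB n -> H) (isUMagmaMorphism.Build _ _ f3 (f31, f3M)).
exists F => i im.
rewrite -[i]/(val (Ordinal im)) sgE rhE /= /mod_free /mod_VB /mod_WB.
by rewrite !f3E !f2E !f1E f0_sg f0_rh.
Qed.

End FlatWelded.

Theorem proposition5p5 (n : nat) (hn : 0 < n) :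
  isomorphic (FWB n) (ZS n).
Proof.
case: n hn => // m _.
pose e (i : nat) : 'I_m.+1 := inord i.
have ordE i j : i <= m -> j <= m -> (e i == e j) = (i == j).
  exact: inord_eq.
have tri i : i.+1 < m -> uniq [:: e i; e i.+1; e i.+2].
  by move=> im; rewrite /= !inE !ordE //; lia.
have quad i j : i < m -> j < m -> far i j -> uniq [:: e i; e i.+1; e j; e j.+1].
  by move=> im jm; rewrite /far /= !inE !ordE //; lia.
pose s i : ZS m.+1 := (xgen (e i) (e i.+1), adj m i).
pose r i : ZS m.+1 := (0%R, adj m i).
have x_fix i j : i < m -> j < m -> far i j ->
    xact (adj m i) (xgen (e j) (e j.+1)) = xgen (e j) (e j.+1).
  move=> im jm ij; have := quad i j im jm ij; rewrite /= !inE !negb_or.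
  case/and4P=> [/and3P[_ ? ?] /andP[? ?] _ _].
  by rewrite xact_gen !tpermD.
have far_sym i j : far i j -> far j i by rewrite /far; lia.
(* Once [s] and [r] satisfy the nine families of relations, the resulting map is bijective by
   [presentation_bij]. *)
have [||||||||| f fE] := @FWB_lift m (ZS m.+1) s r.
- by move=> i /tri; apply: ZS_braid.
- move=> i j im jm ij; apply: ZS_commute; rewrite ?x_fix //.
    exact: far_sym.
  exact/tperm_disjointC/quad.
- by move=> i /tri; apply: ZS_rho_braid.
- move=> i j im jm ij; apply: ZS_commute; rewrite ?xact0 //.
  exact/tperm_disjointC/quad.
- by move=> i _; congr (_, _); rewrite /= ?xact0 ?addr0 ?tperm2.
- move=> i j im jm ij; apply: ZS_commute; rewrite ?xact0 ?x_fix //.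
    exact: far_sym.
  exact/tperm_disjointC/quad.
- by move=> i /tri; apply: ZS_mixed.
- by move=> i /tri; apply: ZS_forbidden.
- by move=> i _; apply: ZS_invol.
exists f.
apply: (presentation_bij (sg := @FWB_sg m) (rh := @FWB_rh m)).
- by move=> i /fE[].
- by move=> i /fE[].
- exact: FWB_rh_braid.
- exact: FWB_rhC.
- exact: FWB_rhK.
- exact: FWB_sgK.
- exact: FWB_sgC.
- exact: FWB_sg_rhC.
- exact: FWB_mixed.
- exact: FWB_forbidden.
- exact: FWB_generated.
Qed.
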